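(* For all formulae $\alpha,\beta$ of $\mathbf{PDBL}$, the following two rules are derivable in $\mathbf{PDBL}$ (the conclusion can be derived from the premise using the axioms and rules of $\mathbf{PDBL}$): (R10) from $\alpha\sqcap\neg\beta\vdash\alpha$ infer $\bot\vdash\alpha\sqcap\beta$; (R11) from $\alpha\vdash\alpha\sqcap\neg\beta$ infer $\alpha\sqcap\beta\vdash\bot$.
   Context: The logic PDBL. Variables: object variables $\mathbf{OV}$ ($p,\dots$) and property variables $\mathbf{PV}$ ($P,\dots$), disjoint countably infinite sets; constants $\top,\bot$; connectives $\sqcap,\sqcup$ (binary), $\neg,\lrcorner$ (unary). $\alpha\vee\beta:=\neg(\neg\alpha\sqcap\neg\beta)$, $\alpha\wedge\beta:=\lrcorner(\lrcorner\alpha\sqcup\lrcorner\beta)$. Sequents $\alpha\vdash\beta$ ($\alpha\dashv\vdash\beta$ means both directions); s-hypersequents are finite sequences $\alpha_1\vdash\beta_1\mid\dots\mid\alpha_n\vdash\beta_n$ (components); $B,C,\dots,X$ range over possibly empty s-hypersequents. Axioms: $\alpha\vdash\alpha$; $\alpha\sqcap\beta\vdash\alpha$; $\alpha\sqcap\beta\vdash\beta$; $\alpha\vdash\alpha\sqcup\beta$; $\beta\vdash\alpha\sqcup\beta$; $\alpha\sqcap\beta\vdash(\alpha\sqcap\beta)\sqcap(\alpha\sqcap\beta)$; $(\alpha\sqcup\beta)\sqcup(\alpha\sqcup\beta)\vdash\alpha\sqcup\beta$; $\neg(\alpha\sqcap\alpha)\vdash\neg\alpha$; $\lrcorner\alpha\vdash\lrcorner(\alpha\sqcup\alpha)$;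 $\alpha\sqcap\neg\alpha\vdash\bot$; $\top\vdash\alpha\sqcup\lrcorner\alpha$; $\neg\neg(\alpha\sqcap\beta)\dashv\vdash\alpha\sqcap\beta$; $\lrcorner\lrcorner(\alpha\sqcup\beta)\dashv\vdash\alpha\sqcup\beta$; $\alpha\sqcap\alpha\vdash\alpha\sqcap(\alpha\sqcup\beta)$; $\alpha\sqcup(\alpha\sqcap\beta)\vdash\alpha\sqcup\alpha$; $\alpha\sqcap\alpha\vdash\alpha\sqcap(\alpha\vee\beta)$; $\alpha\sqcup(\alpha\wedge\beta)\vdash\alpha\sqcup\alpha$; $\alpha\sqcap(\beta\vee\gamma)\dashv\vdash(\alpha\sqcap\beta)\vee(\alpha\sqcap\gamma)$; $\alpha\sqcup(\beta\wedge\gamma)\dashv\vdash(\alpha\sqcup\beta)\wedge(\alpha\sqcup\gamma)$; $\bot\vdash\alpha$; $\alpha\vdash\top$; $\neg\top\vdash\bot$; $\top\vdash\lrcorner\bot$; $\neg\bot\dashv\vdash\top\sqcap\top$; $\lrcorner\top\dashv\vdash\bot\sqcup\bot$; $(\alpha\sqcup\alpha)\sqcap(\alpha\sqcup\alpha)\dashv\vdash(\alpha\sqcap\alpha)\sqcup(\alpha\sqcap\alpha)$; $p\sqcap p\dashv\vdash p$ ($p\in\mathbf{OV}$); $P\sqcup P\dashv\vdash P$ ($P\in\mathbf{PV}$); (Sp) $\alpha\vdash\alpha\sqcap\alpha\mid\alpha\sqcup\alpha\vdash\alpha$. Rules: from $B\mid\alpha\vdash\beta\mid C$ infer $B\mid\alpha\sqcap\gamma\vdash\beta\sqcap\gamma\mid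 C$, $B\mid\gamma\sqcap\alpha\vdash\gamma\sqcap\beta\mid C$, $B\mid\alpha\sqcup\gamma\vdash\beta\sqcup\gamma\mid C$, $B\mid\gamma\sqcup\alpha\vdash\gamma\sqcup\beta\mid C$, $B\mid\neg\beta\vdash\neg\alpha\mid C$, $B\mid\lrcorner\beta\vdash\lrcorner\alpha\mid C$; from $B\mid\alpha\vdash\beta\mid C$ and $D\mid\beta\vdash\gamma\mid E$ infer $B\mid D\mid\alpha\vdash\gamma\mid C\mid E$; from $B\mid\alpha\sqcap\beta\vdash\alpha\sqcap\alpha\mid C$, $D\mid\alpha\sqcap\alpha\vdash\alpha\sqcap\beta\mid E$, $F\mid\alpha\sqcup\beta\vdash\beta\sqcup\beta\mid G$, $H\mid\beta\sqcup\beta\vdash\alpha\sqcup\beta\mid X$ infer $B\mid D\mid F\mid H\mid\alpha\vdash\beta\mid C\mid E\mid G\mid X$; external: from $B\mid D\mid D\mid C$ infer $B\mid D\mid C$; from $B\mid D\mid E\mid C$ infer $B\mid E\mid D\mid C$; from $B$ infer $B\mid C$. *)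

(* Defs.v *)
From Stdlib Require Import List.
Import ListNotations.

Set Implicit Arguments.
Unset Strict Implicit.
Unset Printing Implicit Defensive.

(* [OVar n] and [PVar n] enumerate two disjoint countably infinite sets of
   object and property variables. *)
Inductive formula : Type :=
| OVar (n : nat)
| PVar (n : nat)
| Top
| Bot
| Meet (a b : formula)
| Join (a b : formula)
| Neg (a : formula)
| Opp (a : formula).

Record sequent : Type := Sequent { antecedent : formula; succedent : formula }.

Definition hypersequent : Type := list sequent.

Declare Scope pdbl_scope.
Delimit Scope pdbl_scope with pdbl.
Bind Scope pdbl_scope with formula.
Bind Scope pdbl_scope with sequent.

Notation "⊤" := Top (at level 0) : pdbl_scope.
Notation "⊥" := Bot (at level 0) : pdbl_scope.
Notation "¬ a" := (Neg a) (at level 35, right associativity) : pdbl_scope.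
Notation "⌟ a" := (Opp a) (at level 35, right associativity) : pdbl_scope.
Notation "a ⊓ b" := (Meet a b) (at level 40, left associativity) : pdbl_scope.
Notation "a ⊔ b" := (Join a b) (at level 40, left associativity) : pdbl_scope.
Notation "a ⊢ b" := (Sequent a b) (at level 70, no associativity) : pdbl_scope.

Local Open Scope pdbl_scope.

Definition vee (a b : formula) : formula := ¬ (¬ a ⊓ ¬ b).
Definition wedge (a b : formula) : formula := ⌟ (⌟ a ⊔ ⌟ b).

Notation "a ∨ b" := (vee a b) (at level 40, left associativity) : pdbl_scope.
Notation "a ∧ b" := (wedge a b) (at level 40, left associativity) : pdbl_scope.

(* A two-way axiom a ⊣⊢ b is split into two constructors, suffixed [_lr] for
   a ⊢ b and [_rl] for b ⊢ a. *)
Inductive axiom : hypersequent -> Prop :=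
| ax_id a : axiom [a ⊢ a]
| ax_meet_l a b : axiom [a ⊓ b ⊢ a]
| ax_meet_r a b : axiom [a ⊓ b ⊢ b]
| ax_join_l a b : axiom [a ⊢ a ⊔ b]
| ax_join_r a b : axiom [b ⊢ a ⊔ b]
| ax_meet_dup a b : axiom [a ⊓ b ⊢ (a ⊓ b) ⊓ (a ⊓ b)]
| ax_join_dup a b : axiom [(a ⊔ b) ⊔ (a ⊔ b) ⊢ a ⊔ b]
| ax_neg_meet a : axiom [¬ (a ⊓ a) ⊢ ¬ a]
| ax_opp_join a : axiom [⌟ a ⊢ ⌟ (a ⊔ a)]
| ax_neg_contra a : axiom [a ⊓ ¬ a ⊢ ⊥]
| ax_opp_exmid a : axiom [⊤ ⊢ a ⊔ ⌟ a]
| ax_negneg_lr a b : axiom [¬ ¬ (a ⊓ b) ⊢ a ⊓ b]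
| ax_negneg_rl a b : axiom [a ⊓ b ⊢ ¬ ¬ (a ⊓ b)]
| ax_oppopp_lr a b : axiom [⌟ ⌟ (a ⊔ b) ⊢ a ⊔ b]
| ax_oppopp_rl a b : axiom [a ⊔ b ⊢ ⌟ ⌟ (a ⊔ b)]
| ax_absorb_join a b : axiom [a ⊓ a ⊢ a ⊓ (a ⊔ b)]
| ax_absorb_meet a b : axiom [a ⊔ (a ⊓ b) ⊢ a ⊔ a]
| ax_absorb_vee a b : axiom [a ⊓ a ⊢ a ⊓ (a ∨ b)]
| ax_absorb_wedge a b : axiom [a ⊔ (a ∧ b) ⊢ a ⊔ a]
| ax_distr_meet_lr a b c : axiom [a ⊓ (b ∨ c) ⊢ (a ⊓ b) ∨ (a ⊓ c)]
| ax_distr_meet_rl a b c : axiom [(a ⊓ b) ∨ (a ⊓ c) ⊢ a ⊓ (b ∨ c)]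
| ax_distr_join_lr a b c : axiom [a ⊔ (b ∧ c) ⊢ (a ⊔ b) ∧ (a ⊔ c)]
| ax_distr_join_rl a b c : axiom [(a ⊔ b) ∧ (a ⊔ c) ⊢ a ⊔ (b ∧ c)]
| ax_bot a : axiom [⊥ ⊢ a]
| ax_top a : axiom [a ⊢ ⊤]
| ax_neg_top : axiom [¬ ⊤ ⊢ ⊥]
| ax_opp_bot : axiom [⊤ ⊢ ⌟ ⊥]
| ax_neg_bot_lr : axiom [¬ ⊥ ⊢ ⊤ ⊓ ⊤]
| ax_neg_bot_rl : axiom [⊤ ⊓ ⊤ ⊢ ¬ ⊥]
| ax_opp_top_lr : axiom [⌟ ⊤ ⊢ ⊥ ⊔ ⊥]
| ax_opp_top_rl : axiom [⊥ ⊔ ⊥ ⊢ ⌟ ⊤]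
| ax_square_lr a : axiom [(a ⊔ a) ⊓ (a ⊔ a) ⊢ (a ⊓ a) ⊔ (a ⊓ a)]
| ax_square_rl a : axiom [(a ⊓ a) ⊔ (a ⊓ a) ⊢ (a ⊔ a) ⊓ (a ⊔ a)]
| ax_ovar_lr n : axiom [OVar n ⊓ OVar n ⊢ OVar n]
| ax_ovar_rl n : axiom [OVar n ⊢ OVar n ⊓ OVar n]
| ax_pvar_lr n : axiom [PVar n ⊔ PVar n ⊢ PVar n]
| ax_pvar_rl n : axiom [PVar n ⊢ PVar n ⊔ PVar n]
| ax_sp a : axiom [a ⊢ a ⊓ a; a ⊔ a ⊢ a].

Inductive derives (prems : list hypersequent) : hypersequent -> Prop :=
| d_prem G : In G prems -> derives prems G
| d_axiom G : axiom G -> derives prems G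
| d_meet_mono_l B C a b c :
    derives prems (B ++ [a ⊢ b] ++ C) ->
    derives prems (B ++ [a ⊓ c ⊢ b ⊓ c] ++ C)
| d_meet_mono_r B C a b c :
    derives prems (B ++ [a ⊢ b] ++ C) ->
    derives prems (B ++ [c ⊓ a ⊢ c ⊓ b] ++ C)
| d_join_mono_l B C a b c :
    derives prems (B ++ [a ⊢ b] ++ C) ->
    derives prems (B ++ [a ⊔ c ⊢ b ⊔ c] ++ C)
| d_join_mono_r B C a b c :
    derives prems (B ++ [a ⊢ b] ++ C) ->
    derives prems (B ++ [c ⊔ a ⊢ c ⊔ b] ++ C)
| d_neg B C a b :
    derives prems (B ++ [a ⊢ b] ++ C) ->
    derives prems (B ++ [¬ b ⊢ ¬ a] ++ C)
| d_opp B C a b :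
    derives prems (B ++ [a ⊢ b] ++ C) ->
    derives prems (B ++ [⌟ b ⊢ ⌟ a] ++ C)
| d_cut B C D E a b c :
    derives prems (B ++ [a ⊢ b] ++ C) ->
    derives prems (D ++ [b ⊢ c] ++ E) ->
    derives prems (B ++ D ++ [a ⊢ c] ++ C ++ E)
| d_order B C D E F G H X a b :
    derives prems (B ++ [a ⊓ b ⊢ a ⊓ a] ++ C) ->
    derives prems (D ++ [a ⊓ a ⊢ a ⊓ b] ++ E) ->
    derives prems (F ++ [a ⊔ b ⊢ b ⊔ b] ++ G) ->
    derives prems (H ++ [b ⊔ b ⊢ a ⊔ b] ++ X) ->
    derives prems (B ++ D ++ F ++ H ++ [a ⊢ b] ++ C ++ E ++ G ++ X)
| d_contraction B C D :
    derives prems (B ++ D ++ D ++ C) -> derives prems (B ++ D ++ C)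
| d_exchange B C D E :
    derives prems (B ++ D ++ E ++ C) -> derives prems (B ++ E ++ D ++ C)
| d_weakening B C :
    derives prems B -> derives prems (B ++ C).

Definition derivable_rule (prems : list hypersequent) (concl : hypersequent) :
  Prop := derives prems concl.

(* Main.v *)
(** In (R11) the premise gives α ⊢ ¬β, so α ⊓ β lies below both β and ¬β;
    since α ⊓ β is below its own square, it lies below β ⊓ ¬β, hence below ⊥. *)

Require Import Defs.
From Stdlib Require Import List.
Import ListNotations.

Local Open Scope pdbl_scope.

(** The conclusion of (R10) is an instance of [ax_bot]. (R11) needs [⊓] to act as a greatest lower
    bound, which [derives_meet_glb] provides for antecedents that are themselves meets. *)

Lemma derives_trans prems a b c :
  derives prems [a ⊢ b] -> derives prems [b ⊢ c] -> derives prems [a ⊢ c].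
Proof. exact (@d_cut prems [] [] [] [] a b c). Qed.

Lemma derives_meet_mono prems a b c d :
  derives prems [a ⊢ b] -> derives prems [c ⊢ d] ->
  derives prems [a ⊓ c ⊢ b ⊓ d].
Proof.
  intros Hab Hcd.
  apply derives_trans with (b ⊓ c).
  - exact (@d_meet_mono_l prems [] [] a b c Hab).
  - exact (@d_meet_mono_r prems [] [] c d b Hcd).
Qed.

(** The antecedent is a meet because [x ⊢ x ⊓ x] can fail for general [x], while [ax_meet_dup]
    grants it for meets; monotonicity then sends the two copies to [c] and [d]. *)
Lemma derives_meet_glb prems a b c d :
  derives prems [a ⊓ b ⊢ c] -> derives prems [a ⊓ b ⊢ d] ->
  derives prems [a ⊓ b ⊢ c ⊓ d].
Proof.
  intros Hc Hd.
  apply derives_trans with ((a ⊓ b) ⊓ (a ⊓ b)).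
  - apply d_axiom, ax_meet_dup.
  - now apply derives_meet_mono.
Qed.

Theorem theorem92 (a b : formula) :
  derivable_rule [[a ⊓ ¬ b ⊢ a]] [⊥ ⊢ a ⊓ b] /\
  derivable_rule [[a ⊢ a ⊓ ¬ b]] [a ⊓ b ⊢ ⊥].
Proof.
  split.
  - apply d_axiom, ax_bot.
  - apply derives_trans with (b ⊓ ¬ b); [|apply d_axiom, ax_neg_contra].
    apply derives_meet_glb; [apply d_axiom, ax_meet_r|].
    apply derives_trans with a; [apply d_axiom, ax_meet_l|].
    apply derives_trans with (a ⊓ ¬ b); [now apply d_prem; left|].
    apply d_axiom, ax_meet_r.
Qed.
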